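(* Let $\alpha\in(0,1)$, let $(P_\theta:\theta\in\Theta)$ be a collection of distributions with densities $p_\theta$ with respect to a common measure $\mu$, let $\Theta_0\subset\Theta$, and let $Y_1,Y_2,\dots$ be i.i.d. from $P_{\theta^*}$. For each $t\ge1$ let $\widehat\theta_{1,t-1}\in\Theta$ be any non-anticipating estimator, i.e. one based on $Y_1,\dots,Y_{t-1}$ only, let $\widehat\theta_{0,t}\in\operatorname{argmax}_{\theta\in\Theta_0}\prod_{i=1}^tp_\theta(Y_i)$, and let $$M_t=\frac{\prod_{i=1}^tp_{\widehat\theta_{1,i-1}}(Y_i)}{\prod_{i=1}^tp_{\widehat\theta_{0,t}}(Y_i)} .$$ Consider the running MLE sequential likelihood ratio test of $H_0:\theta^*\in\Theta_0$, which at any time $t$ stops and rejects the null if $M_t>1/\alpha$, and let $\tau_\theta=\inf\{t\ge1:M_t>1/\alpha\}$ (with $\inf\emptyset=\infty$) denote its stopping time when the data are drawn from $P_\theta$. Then this test has type I error at most $\alpha$: $$\sup_{\theta^*\in\Theta_0}P_{\theta^*}(\tau_{\theta^*}<\infty)\le\alpha .$$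
   Context: The initial estimator $\widehat\theta_{1,0}$ is a fixed (deterministic) element of $\Theta$. The null maximum likelihood estimators $\widehat\theta_{0,t}$ are assumed to exist, and all quantities are assumed measurable as needed. *)

(* Defs.v *)
From HB Require Import structures.
From mathcomp Require Import all_boot all_order all_algebra finmap.
From mathcomp Require Import all_classical all_reals all_analysis measurable_realfun.
Set Implicit Arguments.
Unset Strict Implicit.
Unset Printing Implicit Defensive.
Import Order.TTheory GRing.Theory Num.Theory.
Import numFieldNormedType.Exports.

Local Open Scope classical_set_scope.
Local Open Scope ring_scope.
Local Open Scope ereal_scope.

Section Sampling.
Context {d d' : measure_display} {T : measurableType d}
  {Omega : measurableType d'} {R : realType}.

Definition is_density (mu : {measure set T -> \bar R})
    (P : probability T R) (f : T -> R) : Prop :=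
  [/\ measurable_fun setT f,
      forall y, (0 <= f y)%R &
      forall A, measurable A -> P A = \int[mu]_(y in A) (f y)%:E].

Definition mutually_independent (Pr : probability Omega R)
    (Y : nat -> {mfun Omega >-> T}) : Prop :=
  forall (J : {fset nat}) (A : nat -> set T),
    (forall i, measurable (A i)) ->
    Pr (\bigcap_(i in [set` J]) (Y i @^-1` A i))
      = \prod_(i <- J) Pr (Y i @^-1` A i).

Definition iid_from (Pr : probability Omega R)
    (Y : nat -> {mfun Omega >-> T}) (P : probability T R) : Prop :=
  mutually_independent Pr Y /\
  forall i A, measurable A -> distribution Pr (Y i) A = P A.

End Sampling.

(* Observations are numbered from 0: for a data sequence [y : nat -> T], the
   i-th observation (i >= 1) is [y i.-1], and [prefix_tuple y t] collects the
   first t of them.  An estimator computed from a sample of size n is a function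
   on [n.-tuple T]; in particular one based on no observation is a constant. *)
Definition prefix_tuple {T : Type} (y : nat -> T) (t : nat) : t.-tuple T :=
  [tuple y i | i < t].

Section RunningMLE.
Context {T Theta : Type} {R : realType}.
Variable p : Theta -> T -> R.

Definition likelihood (theta : Theta) (t : nat) (s : t.-tuple T) : R :=
  (\prod_(i < t) p theta (tnth s i))%R.

Definition is_MLE (Theta0 : set Theta) (t : nat) (s : t.-tuple T)
    (theta : Theta) : Prop :=
  Theta0 theta /\
  forall theta', Theta0 theta' -> (likelihood theta' s <= likelihood theta s)%R.

Variables (est1 est0 : forall n : nat, n.-tuple T -> Theta).

Definition running_likelihood (t : nat) (y : nat -> T) : R :=
  (\prod_(i < t) p (est1 (prefix_tuple y i)) (y i))%R.

(* The quotient is taken in the extended reals, so that a / 0 = +oo for a > 0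
   (the test then rejects); the library convention is 0 / 0 = 0. *)
Definition running_MLE_ratio (t : nat) (y : nat -> T) : \bar R :=
  (running_likelihood t y)%:E /
  (likelihood (est0 (prefix_tuple y t)) (prefix_tuple y t))%:E.

Definition rejection_time (alpha : R) (y : nat -> T) : \bar R :=
  ereal_inf [set t%:R%:E | t in
    [set t : nat | (1 <= t)%N /\ (alpha^-1)%:E < running_MLE_ratio t y]].

End RunningMLE.

(* Main.v *)
(* Fix theta in Theta0 and let f be its density.  As the null MLE maximizes the
   likelihood over Theta0, M_t <= L_t, where L_t is the product over i <= t of
   p_(est1 (i-1)) (Y_i) / f (Y_i), outside the null event that some f (Y_i)
   vanishes.  Given Y_1, ..., Y_(i-1), the i-th factor integrates to at most 1,
   because (Y_1, ..., Y_(i-1)) and Y_i are independent: L is a nonnegative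
   supermartingale started at 1.  Ville's inequality then bounds the probability
   that L ever exceeds 1/alpha by alpha.  It is obtained without conditional
   expectations: the product frozen as soon as it exceeds c still has
   expectation at most 1, and it exceeds c at time n if L has done so at any time t <= n, so
   that Markov's inequality at time n suffices. *)

Require Import Defs.
From HB Require Import structures.
From mathcomp Require Import all_boot all_order all_algebra finmap.
From mathcomp Require Import all_classical all_reals all_analysis measurable_realfun.
Set Implicit Arguments.
Unset Strict Implicit.
Unset Printing Implicit Defensive.
Import Order.TTheory GRing.Theory Num.Theory.
Import numFieldNormedType.Exports.

Local Open Scope classical_set_scope.
Local Open Scope ring_scope.
Local Open Scope ereal_scope.

Import HBNNSimple.

(** Inversion is continuous on the open complement of 0, and any function is measurable on the
    singleton of 0; the two pieces are glued. *)
Lemma measurable_invr (R : realType) : measurable_fun setT (@GRing.inv R).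
Proof.
rewrite -(setUv [set (0 : R)%R]); apply/measurable_funU => //.
  exact: measurableC.
split; first exact: measurable_fun_set1.
apply: open_continuous_measurable_fun.
  by rewrite openC; exact: closed_eq.
by move=> x; rewrite inE => /eqP x0; exact: inv_continuous.
Qed.

(** * Integration against a density and likelihood ratios *)

Section density.
Context {d : measure_display} {T : measurableType d} {R : realType}.
Variable mu : {measure set T -> \bar R}.
Implicit Types (P Q : probability T R) (f g : T -> R) (h : T -> \bar R).

(* [mu] is not assumed sigma-finite, so the change of variables available for
   Radon-Nikodym derivatives does not apply. *)
Lemma ge0_integral_density P f h : is_density mu P f ->
  measurable_fun setT h -> (forall y, 0 <= h y) ->
  \int[P]_y h y = \int[mu]_y (h y * (f y)%:E).
Proof.
move=> [mf f0 Pf] mh h0.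
pose u := nnsfun_approx measurableT mh.
have uh y : (EFin \o u^~ y) n @[n --> \oo] --> h y.
  exact: cvg_nnsfun_approx.
have nd_u y : {homo (fun n => (u n y)%:E) : m n / (m <= n)%N >-> m <= n}.
  by move=> m n mn; rewrite lee_fin; exact/lefP/nd_nnsfun_approx.
(* On a simple function the identity is a finite sum of instances of the defining property of [f],
   one per level set; monotone convergence under [P] and under [mu] then carries it to [h]. *)
have muf n : \int[mu]_y ((u n y)%:E * (f y)%:E) = \int[P]_y (u n y)%:E.
  rewrite integralT_nnsfun sintegralE.
  have uE y : (u n y)%:E * (f y)%:E = \sum_(r \in range (u n))
      ((r * \1_(u n @^-1` [set r]) y)%:E * (f y)%:E).
    rewrite fimfunE -fsumEFin// ge0_mule_fsuml//.
    by move=> r; exact: nnfun_muleindic_ge0.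
  under eq_integral do rewrite uE.
  rewrite ge0_integral_fsum//; last 2 first.
  - move=> r; apply: emeasurable_funM; last exact/measurable_EFinP.
    by apply/measurable_EFinP; exact: measurable_funM.
  - by move=> r y _; rewrite mule_ge0 ?nnfun_muleindic_ge0 ?lee_fin.
  apply: eq_fsbigr => r; rewrite inE => -[y _ <-].
  under eq_integral do rewrite EFinM -muleA.
  rewrite ge0_integralZl//; last 3 first.
  - by apply: emeasurable_funM; apply/measurable_EFinP.
  - by move=> z _; rewrite mule_ge0 ?lee_fin.
  - by rewrite lee_fin.
  congr (_ * _); apply: etrans (esym (Pf _ _)) => //.
  rewrite [RHS]integral_mkcond.
  by apply: eq_integral => z _; rewrite epatch_indic muleC.
transitivity (limn (fun n => \int[P]_y (u n y)%:E)).
  rewrite -monotone_convergence//.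
  - by apply: eq_integral => y _; exact/esym/cvg_lim/uh.
  - by move=> n; exact/measurable_EFinP.
  - by move=> n y _; rewrite lee_fin.
under [in LHS]eq_fun do rewrite -muf.
rewrite -monotone_convergence//.
- apply: eq_integral => y _; apply/cvg_lim => //.
  by apply: cvgeZr => //; exact: uh.
- by move=> n; apply: emeasurable_funM; exact/measurable_EFinP.
- by move=> n y _; rewrite mule_ge0 ?lee_fin.
- by move=> y _ m n mn; rewrite lee_wpmul2r ?lee_fin//; exact: nd_u.
Qed.

Lemma is_density_integralT P f : is_density mu P f -> \int[mu]_y (f y)%:E = 1.
Proof. by move=> [_ _ Pf]; rewrite -Pf// probability_setT. Qed.

Lemma is_density_eq0 P f : is_density mu P f -> P (f @^-1` [set 0%R]) = 0.
Proof.
move=> [mf f0 Pf].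
rewrite Pf; last by rewrite -[X in measurable X]setTI; exact: mf.
by rewrite integral0_eq// => y /= ->.
Qed.

(* The integral can be less than 1: as [x / 0 = 0], it is the mass that [Q] puts
   on the set where [f] is positive. *)
Lemma integral_likelihood_ratio_le1 P Q f g :
  is_density mu P f -> is_density mu Q g -> \int[P]_y (g y / f y)%:E <= 1.
Proof.
move=> dP dQ; have [mf f0 _] := dP; have [mg g0 _] := dQ.
have mgf : measurable_fun setT (fun y => (g y / f y)%R).
  apply: measurable_funM => //.
  exact: measurableT_comp (@measurable_invr R) mf.
rewrite (ge0_integral_density dP); last 2 first.
- exact/measurable_EFinP.
- by move=> y; rewrite lee_fin divr_ge0.
rewrite -(is_density_integralT dQ); apply: ge0_le_integral => //.
- by move=> y _; rewrite mule_ge0 ?lee_fin ?divr_ge0.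
- by apply: emeasurable_funM; exact/measurable_EFinP.
- exact/measurable_EFinP.
move=> y _; rewrite -EFinM lee_fin.
(* Multiplying back by [f y] gives 0 where [f] vanishes and exactly [g y] elsewhere. *)
by have [->|fy] := eqVneq (f y) 0%R; rewrite ?mulr0// divfK.
Qed.

End density.

(** * Boxes generating the product sigma-algebra on tuples *)

Section tuple_boxes.
Context {d : measure_display} {T : measurableType d}.
Variable n : nat.

(** The sides are indexed by [nat] rather than ['I_n], so that the same family can be handed to
    [mutually_independent]. *)
Definition tuple_box (A : nat -> set T) : set (n.-tuple T) :=
  [set s | forall i : 'I_n, A i (tnth s i)].

Definition measurable_tuple_boxes : set (set (n.-tuple T)) :=
  [set B | exists2 A, forall i, measurable (A i) & B = tuple_box A].

Lemma measurable_tuple_box A :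
  (forall i, measurable (A i)) -> measurable (tuple_box A).
Proof.
move=> mA.
rewrite (_ : tuple_box A =
  \bigcap_(i in [set: 'I_n]) (@tnth n T ^~ i @^-1` A i)).
  apply: fin_bigcap_measurable => // i _.
  by rewrite -[X in measurable X]setTI; exact: measurable_tnth.
by apply/seteqP; split => [s As i _|s As i]; [exact: As|exact: (As i)].
Qed.

Lemma tuple_boxT : tuple_box (fun=> setT) = setT.
Proof. by apply/seteqP; split. Qed.

Lemma setI_closed_tuple_boxes : setI_closed measurable_tuple_boxes.
Proof.
move=> _ _ [A mA ->] [B mB ->].
exists (fun i => A i `&` B i); first by move=> i; exact: measurableI.
by apply/seteqP; split => [s [As Bs] i|s ABs];
  [split|split => i; case: (ABs i)].
Qed.

(** A generating cylinder is a box with all sides but one equal to [setT], and each box is a finite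
    intersection of cylinders. Boxes thus form a generating pi-system. *)
Lemma measurable_tuple_boxesE :
  @measurable _ (n.-tuple T) = <<s measurable_tuple_boxes >>.
Proof.
apply/seteqP; split; last first.
  apply: smallest_sub; first exact: sigma_algebra_measurable.
  by move=> _ [A mA ->]; exact: measurable_tuple_box.
apply: smallest_sub; first exact: smallest_sigma_algebra.
move=> B; rewrite -bigcup_seq => -[i _ [A mA <-]].
apply: sub_sigma_algebra.
exists (fun j => if j == i :> nat then A else setT).
  by move=> j; case: ifP.
rewrite setTI; apply/seteqP; split => [s As j|s /(_ i)] /=.
  by case: ifPn => // /eqP/val_inj ->.
by rewrite eqxx.
Qed.

End tuple_boxes.

(** * Independence of the past sample and the next observation *)

Section independent_sample.
Context {d d' : measure_display} {T : measurableType d}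
  {Omega : measurableType d'} {R : realType}.
Variables (Pr : probability Omega R) (Y : nat -> {mfun Omega >-> T}).
Variable P : probability T R.
Hypothesis Y_iid : iid_from Pr Y P.

Definition sample_prefix n (w : Omega) : n.-tuple T :=
  prefix_tuple (fun i => Y i w) n.

Lemma measurable_sample_prefix n : measurable_fun setT (sample_prefix n).
Proof.
apply/measurable_fun_tnthP => i.
rewrite (_ : _ \o _ = Y i)//.
by apply/funext => w /=; rewrite tnth_mktuple.
Qed.

HB.instance Definition _ n :=
  isMeasurableFun.Build _ _ _ _ (sample_prefix n) (@measurable_sample_prefix n).

Definition prefix_next n (w : Omega) : n.-tuple T * T :=
  (sample_prefix n w, Y n w).

Lemma measurable_prefix_next n : measurable_fun setT (prefix_next n).
Proof. exact: measurable_fun_pair. Qed.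

HB.instance Definition _ n :=
  isMeasurableFun.Build _ _ _ _ (prefix_next n) (@measurable_prefix_next n).

(** Mutual independence is applied twice, to the indices below [n] and to these together with [n],
    where [AB] places [B] at index [n]; the quotient of the two products is the factor at [n]. *)
Lemma prefix_next_indep_box n (A : nat -> set T) (B : set T) :
  (forall i, measurable (A i)) -> measurable B ->
  Pr (sample_prefix n @^-1` tuple_box A `&` Y n @^-1` B) =
  Pr (sample_prefix n @^-1` tuple_box A) * P B.
Proof.
move=> mA mB; have [indep idP] := Y_iid.
pose J := [fset i in iota 0 n]%fset.
have J_n : n \notin J by rewrite inE /= mem_iota add0n ltnn.
pose AB i := if i == n then B else A i.
have mAB i : measurable (AB i) by rewrite /AB; case: ifP.
have preA : sample_prefix n @^-1` tuple_box A =
    \bigcap_(i in [set` J]) (Y i @^-1` A i).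
  apply/seteqP; split => w /= Aw i.
    rewrite /= inE /= mem_iota add0n => i_n.
    by have := Aw (Ordinal i_n); rewrite tnth_mktuple.
  by rewrite tnth_mktuple; apply: Aw; rewrite /= inE /= mem_iota add0n ltn_ord.
have preAB : sample_prefix n @^-1` tuple_box A `&` Y n @^-1` B =
    \bigcap_(i in [set` (n |` J)%fset]) (Y i @^-1` AB i).
  rewrite preA; apply/seteqP; split => w /=.
    move=> [Aw Bw] i /=; rewrite in_fset1U /AB.
    by case: eqVneq => [->//|_ /= iJ]; exact: Aw.
  move=> ABw; split.
    move=> i /= iJ; have := ABw i; rewrite /= in_fset1U iJ orbT /AB.
    by case: eqVneq iJ J_n => [-> ->//|_ _ _]; apply.
  by have := ABw n; rewrite /= in_fset1U eqxx /AB eqxx; apply.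
rewrite preAB indep// big_fsetU1// preA indep// /AB eqxx [RHS]muleC.
congr (_ * _); first exact: (idP n B mB).
rewrite [LHS]big_seq [RHS]big_seq; apply: eq_bigr => i iJ.
by case: eqVneq iJ J_n => // -> ->.
Qed.

(** For fixed [B] both sides are finite measures in [A] that agree on boxes, hence everywhere. *)
Lemma prefix_next_indep n (A : set (n.-tuple T)) (B : set T) :
  measurable A -> measurable B ->
  Pr (sample_prefix n @^-1` A `&` Y n @^-1` B) =
  Pr (sample_prefix n @^-1` A) * P B.
Proof.
move=> mA mB.
have mYB : measurable (Y n @^-1` B).
  by rewrite -[X in measurable X]setTI; exact: measurable_funPT.
have PB : P B = (fine (P B))%:E by rewrite fineK// fin_num_measure.
have PB0 : (0 <= fine (P B))%R by rewrite fine_ge0.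
(* [m1] is the law of the past restricted to the event that [Y n] lies in [B]; [m2] is the full law
   of the past scaled by [P B]. *)
pose m1 := pushforward (mrestr Pr mYB) (sample_prefix n).
pose m2 := mscale (NngNum PB0) (distribution Pr (sample_prefix n)).
rewrite [RHS]muleC [in RHS]PB.
apply: (measure_unique (@measurable_tuple_boxes _ T n) (fun=> setT)
  _ _ _ _ m1 m2) => //.
- exact: measurable_tuple_boxesE.
- exact: setI_closed_tuple_boxes.
- by move=> _; exists (fun=> setT) => //; rewrite tuple_boxT.
- by rewrite bigcup_const//; exists 0%N.
- move=> _ [C mC ->]; rewrite /m1 /m2 /= /pushforward/= /mrestr /mscale/=.
  by rewrite -PB muleC; exact: prefix_next_indep_box.
- move=> _; rewrite /m1 /pushforward /mrestr.
  by rewrite -ge0_fin_numE// fin_num_measure//; exact: measurableT.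
Qed.

(** By independence the joint law is a product measure, so Tonelli's theorem applies. The inner
    integral plays the role of a conditional expectation given the past. *)
Lemma integral_prefix_next n (G : n.-tuple T * T -> \bar R) :
  measurable_fun setT G -> (forall z, 0 <= G z) ->
  \int[Pr]_w G (sample_prefix n w, Y n w) =
  \int[Pr]_w \int[P]_y G (sample_prefix n w, y).
Proof.
move=> mG G0.
transitivity (\int[distribution Pr (prefix_next n)]_z G z).
  by rewrite ge0_integral_distribution.
transitivity (\int[distribution Pr (sample_prefix n) \x P]_z G z).
  apply: eq_measure_integral => A mA _; apply/esym.
  apply: product_measure_unique => // B C mB mC.
  exact: prefix_next_indep.
rewrite fubini_tonelli1// ge0_integral_distribution//.
  exact: measurable_fun_fubini_tonelli_F.
by move=> s; exact: integral_ge0.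
Qed.

End independent_sample.

(** * Products of past-dependent factors, frozen above a level *)

Section stopped_product.
Context {T : Type} {R : realType}.
Variables (g : forall n, n.-tuple T * T -> R) (c : R).

Definition tuple_init n (s : n.+1.-tuple T) : n.-tuple T :=
  [tuple tnth s (widen_ord (leqnSn n) i) | i < n].

Lemma tuple_init_prefix (y : nat -> T) n :
  tuple_init (prefix_tuple y n.+1) = prefix_tuple y n.
Proof. by apply: eq_from_tnth => i; rewrite !tnth_mktuple. Qed.

Definition sequential_product n (y : nat -> T) : R :=
  (\prod_(i < n) g (prefix_tuple y i, y i))%R.

(* Freezing the product once it exceeds [c] makes the event that it exceeds [c]
   nondecreasing in [n]. *)
Fixpoint stopped_product n : n.-tuple T -> R :=
  if n is m.+1 then fun s =>
    (let x := stopped_product (tuple_init s) in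
     x * (if c < x then 1 else g (tuple_init s, tnth s ord_max)))%R
  else fun=> 1%R.

Lemma stopped_productS n (y : nat -> T) :
  stopped_product (prefix_tuple y n.+1) =
  (stopped_product (prefix_tuple y n) *
   (if c < stopped_product (prefix_tuple y n) then 1
    else g (prefix_tuple y n, y n)))%R.
Proof. by rewrite /= tuple_init_prefix tnth_mktuple. Qed.

Lemma stopped_product_gt n (y : nat -> T) :
  (c < sequential_product n y)%R -> (c < stopped_product (prefix_tuple y n))%R.
Proof.
suff [] : (c < stopped_product (prefix_tuple y n))%R \/
    stopped_product (prefix_tuple y n) = sequential_product n y by [|move=> ->].
elim: n => [|n IH]; first by right; rewrite /sequential_product big_ord0.
rewrite stopped_productS.
case: ifPn => [cn|cn]; first by left; rewrite mulr1.
case: IH => [|->]; first by rewrite (negPf cn).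
by right; rewrite /sequential_product big_ord_recr.
Qed.

Lemma stopped_product_gtS n (y : nat -> T) :
  (c < stopped_product (prefix_tuple y n))%R ->
  (c < stopped_product (prefix_tuple y n.+1))%R.
Proof. by rewrite stopped_productS => cn; rewrite cn mulr1. Qed.

End stopped_product.

Section measurable_stopped_product.
Context {d : measure_display} {T : measurableType d} {R : realType}.
Variables (g : forall n, n.-tuple T * T -> R) (c : R).
Hypothesis mg : forall n, measurable_fun setT (@g n).
Hypothesis g0 : forall n z, (0 <= @g n z)%R.

Lemma measurable_tuple_init n : measurable_fun setT (@tuple_init T n).
Proof.
apply/measurable_fun_tnthP => i.
rewrite (_ : _ \o _ = @tnth n.+1 T ^~ (widen_ord (leqnSn n) i)).
  exact: measurable_tnth.
by apply/funext => s /=; rewrite tnth_mktuple.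
Qed.

Lemma measurable_stopped_product n :
  measurable_fun setT (@stopped_product _ _ g c n).
Proof.
elim: n => [|n IH] /=; first exact: measurable_cst.
have mI : measurable_fun setT
    (fun s => stopped_product g c (@tuple_init T n s)).
  exact: measurableT_comp IH (measurable_tuple_init (n:=n)).
apply: measurable_funM => //; apply: measurable_fun_ifT => //.
  exact: measurable_fun_ltr.
apply: (measurableT_comp (@mg n)); apply: measurable_fun_pair.
  exact: measurable_tuple_init.
exact: measurable_tnth.
Qed.

Lemma stopped_product_ge0 n s : (0 <= @stopped_product _ _ g c n s)%R.
Proof.
elim: n s => [|n IH] s /=; first exact: ler01.
by rewrite mulr_ge0//; case: ifP.
Qed.

End measurable_stopped_product.

(** * Ville's inequality for products whose factors have conditional mean at most 1 *)

Section ville.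
Context {d d' : measure_display} {T : measurableType d}
  {Omega : measurableType d'} {R : realType}.
Variables (Pr : probability Omega R) (Y : nat -> {mfun Omega >-> T}).
Variable P : probability T R.
Hypothesis Y_iid : iid_from Pr Y P.
Variable g : forall n, n.-tuple T * T -> R.
Hypothesis mg : forall n, measurable_fun setT (@g n).
Hypothesis g0 : forall n z, (0 <= @g n z)%R.
Hypothesis g1 : forall n s, \int[P]_y (@g n (s, y))%:E <= 1.

Lemma measurable_sequential_product n :
  measurable_fun setT (fun w => sequential_product g n (fun i => Y i w)).
Proof.
apply: measurable_prod => i _.
exact: measurableT_comp (@mg i) (measurable_prefix_next Y (n:=i)).
Qed.

Lemma expectation_stopped_product_le1 c n :
  \int[Pr]_w (stopped_product g c (sample_prefix Y n w))%:E <= 1.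
Proof.
elim: n => [|n IH].
  by rewrite /= integral_cst// mul1e; exact: probability_le1.
pose G (z : n.-tuple T * T) : \bar R := (stopped_product g c z.1 *
  (if c < stopped_product g c z.1 then 1 else g z))%:E%R.
have mS := measurable_stopped_product c mg.
have S0 := stopped_product_ge0 c g0.
have mS1 : measurable_fun setT
    (fun z : n.-tuple T * T => stopped_product g c z.1).
  exact: (measurableT_comp (mS n)).
have mw : measurable_fun setT (fun z : n.-tuple T * T =>
    if (c < stopped_product g c z.1)%R then 1%R else g z).
  apply: measurable_fun_ifT => //; last exact: mg.
  exact: (measurable_fun_ltr (measurable_cst c) mS1).
have w0 (z : n.-tuple T * T) :
    (0 <= if (c < stopped_product g c z.1)%R then 1 else g z)%R by case: ifP.
have mG : measurable_fun setT G.
  by apply/measurable_EFinP; exact: measurable_funM.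
have G0 z : 0 <= G z by rewrite lee_fin; apply: mulr_ge0; [exact: S0|exact: w0].
have SG w : (stopped_product g c (sample_prefix Y n.+1 w))%:E =
    G (sample_prefix Y n w, Y n w) by rewrite /sample_prefix stopped_productS.
under eq_integral do rewrite SG.
rewrite (integral_prefix_next Y_iid mG G0); apply: le_trans IH.
apply: ge0_le_integral => //.
- by move=> w _; exact: integral_ge0.
- apply: (measurableT_comp (measurable_fun_fubini_tonelli_F _ mG G0)).
  exact: measurable_sample_prefix.
- apply/measurable_EFinP.
  exact: (measurableT_comp (mS n) (measurable_sample_prefix Y (n:=n))).
move=> w _; rewrite /G/=; under eq_integral do rewrite EFinM.
rewrite ge0_integralZl//; last 3 first.
- apply/measurable_EFinP.
  have mp : measurable_fun setT (fun y : T => (sample_prefix Y n w, y)).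
    exact: measurable_fun_pair.
  by case: (_ < _)%R => //; exact: (measurableT_comp (@mg n) mp).
- by move=> y _; rewrite lee_fin; exact: (w0 (_, _)).
- by rewrite lee_fin.
rewrite -[leRHS]mule1 lee_wpmul2l ?lee_fin//.
(* Once frozen, the new factor is the constant 1, whose integral is also at most 1. *)
case: (_ < _)%R; last exact: g1.
by rewrite integral_cst// mul1e; exact: probability_le1.
Qed.

Lemma ville_sequential_product c : (0 < c)%R ->
  Pr (\bigcup_n [set w | c < sequential_product g n (fun i => Y i w)]%R)
  <= (c^-1)%:E.
Proof.
move=> c0.
pose S n w := stopped_product g c (sample_prefix Y n w).
pose F n := [set w | c < S n w]%R.
have mS n : measurable_fun setT (S n).
  apply: measurableT_comp (measurable_sample_prefix Y (n:=n)).
  exact: measurable_stopped_product.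
have mF n : measurable (F n).
  rewrite -[F n]setTI; exact: (measurable_fun_ltr (measurable_cst c) (mS n)).
have S0 n w : (0 <= S n w)%R by exact: stopped_product_ge0.
have FS n : F n `<=` F n.+1 by move=> w; exact: stopped_product_gtS.
(* Markov's inequality: [c] times the indicator of [F n] is at most [S n] pointwise, and [S n] has
   expectation at most 1. *)
have PF n : Pr (F n) <= (c^-1)%:E.
  rewrite -[leRHS]mul1e lee_pdivlMr// muleC.
  apply: le_trans (expectation_stopped_product_le1 c n).
  rewrite -integral_cst// integral_mkcond; apply: ge0_le_integral => //.
  - by move=> w _; rewrite patchE; case: ifP; rewrite // lee_fin ltW.
  - by apply/(measurable_restrictT _ _).1.
  - exact/measurable_EFinP/mS.
  move=> w _; rewrite patchE; case: ifPn => [|_]; last by rewrite lee_fin S0.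
  by rewrite inE lee_fin => /ltW.
have mU : measurable (\bigcup_n F n) by exact: bigcup_measurable.
apply: (@le_trans _ _ (Pr (\bigcup_n F n))).
  apply: le_measure; rewrite ?inE//.
    apply: bigcup_measurable => n _; rewrite -[X in measurable X]setTI.
    exact: (measurable_fun_ltr (measurable_cst c)
      (measurable_sequential_product n)).
  by move=> w [n _ cn]; exists n => //; exact: stopped_product_gt.
(* The events [F n] increase, so continuity from below passes the uniform bound to their union. *)
have cvgF : (Pr \o F) n @[n --> \oo] --> Pr (\bigcup_n F n).
  apply: nondecreasing_cvg_mu => //.
  by apply/nondecreasing_seqP => n; exact/subsetPset.
rewrite -(cvg_lim _ cvgF)//; apply: lime_le.
  by apply/cvg_ex; eexists; exact: cvgF.
by near=> n; exact: PF.
Unshelve. all: end_near. Qed.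

End ville.

(** * The rejection event of the running MLE test *)

Lemma rejection_time_fin (T Theta : Type) (R : realType) (p : Theta -> T -> R)
    (est1 est0 : forall n : nat, n.-tuple T -> Theta) (alpha : R)
    (y : nat -> T) :
  rejection_time p est1 est0 alpha y < +oo <->
  exists2 t, (1 <= t)%N & (alpha^-1)%:E < running_MLE_ratio p est1 est0 t y.
Proof.
(* An infimum of finite numbers is below [+oo] exactly when the set is nonempty. *)
split=> [/ereal_inf_lt[_ [t [t1 Mt] _] _]|[t t1 Mt]]; first by exists t.
by apply/ereal_inf_ltP; exists t%:R%:E; [exists t|exact: ltry].
Qed.

(** Since [theta] competes in the maximization over [Theta0], replacing the MLE by [theta] can only
    lower the denominator. It stays positive as no factor vanishes, so both quotients are genuine
    real ones. *)
Lemma running_MLE_ratio_le (T Theta : Type) (R : realType)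
    (p : Theta -> T -> R) (est1 est0 : forall n : nat, n.-tuple T -> Theta)
    (Theta0 : set Theta) (theta : Theta) (t : nat) (y : nat -> T) :
  (forall th x, 0 <= p th x)%R -> Theta0 theta ->
  (forall i, p theta (y i) != 0)%R ->
  is_MLE p Theta0 (prefix_tuple y t) (est0 t (prefix_tuple y t)) ->
  running_MLE_ratio p est1 est0 t y <=
  (sequential_product (fun n z => p (est1 n z.1) z.2 / p theta z.2)%R t y)%:E.
Proof.
move=> p0 Theta0theta py [_ /(_ _ Theta0theta)].
have lik : likelihood p theta (prefix_tuple y t) =
    (\prod_(i < t) p theta (y i))%R.
  by apply: eq_bigr => i _; rewrite tnth_mktuple.
have lik0 : (0 < likelihood p theta (prefix_tuple y t))%R.
  by rewrite lik; apply: prodr_gt0 => i _; rewrite lt_neqAle eq_sym py p0.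
move=> le_lik; have lik1 := lt_le_trans lik0 le_lik.
rewrite /running_MLE_ratio inver gt_eqF// -EFinM lee_fin.
rewrite /sequential_product prodf_div -lik ler_wpM2l//.
  by apply: prodr_ge0.
by rewrite lef_pV2.
Qed.

Theorem theorem9 (R : realType) (d d' : measure_display)
  (T : measurableType d) (mu : {measure set T -> \bar R})
  (Theta : Type) (Theta0 : set Theta)
  (P : Theta -> probability T R) (p : Theta -> T -> R)
  (Omega : Theta -> measurableType d')
  (Pr : forall theta : Theta, probability (Omega theta) R)
  (Y : forall theta : Theta, nat -> {mfun Omega theta >-> T})
  (est1 est0 : forall n : nat, n.-tuple T -> Theta)
  (alpha : R) :
  (0 < alpha < 1)%R ->
  (forall theta, is_density mu (P theta) (p theta)) ->
  (forall theta, iid_from (Pr theta) (Y theta) (P theta)) ->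
  (forall theta (w : Omega theta) (t : nat), (1 <= t)%N ->
     let s := prefix_tuple (fun i => Y theta i w) t in
     is_MLE p Theta0 s (est0 t s)) ->
  (forall n : nat,
     measurable_fun setT
       (fun z : n.-tuple T * T => p (est1 n z.1) z.2)) ->
  (forall theta (t : nat), (1 <= t)%N ->
     measurable_fun setT
       (fun w : Omega theta =>
          running_MLE_ratio p est1 est0 t (fun i => Y theta i w))) ->
  ereal_sup
    [set Pr theta
           [set w : Omega theta |
              rejection_time p est1 est0 alpha (fun i => Y theta i w) < +oo]
       | theta in Theta0]
  <= alpha%:E.
Proof.
move=> /andP[alpha0 _] dens iid mle mest mratio.
have p0 th x : (0 <= p th x)%R by case: (dens th).
apply/ge_ereal_sup => _ [theta Theta0theta <-].
pose M t w := running_MLE_ratio p est1 est0 t (fun i => Y theta i w).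
pose g n (z : n.-tuple T * T) := (p (est1 n z.1) z.2 / p theta z.2)%R.
pose L n w := sequential_product g n (fun i => Y theta i w).
have [mp _ _] := dens theta.
have mg n : measurable_fun setT (g n).
  apply: measurable_funM; first exact: mest.
  have mp2 : measurable_fun setT (fun z : n.-tuple T * T => p theta z.2).
    exact: (measurableT_comp mp).
  exact: (measurableT_comp (@measurable_invr R) mp2).
have g0 n z : (0 <= g n z)%R by rewrite divr_ge0.
have g1 n s : \int[P theta]_y (g n (s, y))%:E <= 1.
  (* Once the past [s] is fixed, [est1 n s] is a fixed parameter and its [p] is a density. *)
  exact: integral_likelihood_ratio_le1 (dens theta) (dens (est1 n s)).
pose V := \bigcup_n [set w | (alpha^-1 < L n w)%R].
have mV : measurable V.
  apply: bigcup_measurable => n _; rewrite -[X in measurable X]setTI.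
  apply: (measurable_fun_ltr (measurable_cst _)) => //.
  exact: measurable_sequential_product.
have PV : Pr theta V <= alpha%:E.
  rewrite -[alpha]invrK; apply: (ville_sequential_product (iid theta)) => //.
  by rewrite invr_gt0.
pose Z := p theta @^-1` [set 0%R].
have mZ : measurable Z by rewrite -[Z]setTI; exact: mp.
(* On [N] some [p theta (Y_i)] is 0, so [L] vanishes from then on by the convention [x / 0 = 0] and
   need no longer dominate [M]. *)
pose N := \bigcup_i (Y theta i @^-1` Z).
have mYZ i : measurable (Y theta i @^-1` Z).
  by rewrite -[X in measurable X]setTI; exact: measurable_funPT.
have mN : measurable N by exact: bigcup_measurable.
have PN : Pr theta N = 0.
  apply/negligibleP => //; apply: negligible_bigcup => i.
  apply/negligibleP => //.
  by have [_ /(_ i Z mZ)] := iid theta; rewrite (is_density_eq0 (dens theta)).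
set E := [set w | _].
have EE : E = \bigcup_(t in [set t | (1 <= t)%N])
    [set w | (alpha^-1)%:E < M t w].
  apply/seteqP; split => w.
    by move=> /rejection_time_fin[t t1 Mt]; exists t.
  by move=> [t t1 Mt]; apply/rejection_time_fin; exists t.
have mE : measurable E.
  rewrite EE; apply: bigcup_measurable => t t1.
  rewrite -[X in measurable X]setTI.
  exact: emeasurable_fun_o_infty (mratio theta t t1) _.
(* Outside [N], [M] is at most [L] at the same time [t], so a rejection forces [L] above
   [alpha^-1]. *)
have EVN : E `<=` V `|` N.
  rewrite EE => w [t t1 Mt]; have [Nw|Nw] := pselect (N w); first by right.
  left; exists t => //=; rewrite -lte_fin; apply: (lt_le_trans Mt).
  apply: (running_MLE_ratio_le _ p0 Theta0theta _ (mle theta w t t1)) => i.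
  by apply/eqP => py; apply: Nw; exists i.
apply: (@le_trans _ _ (Pr theta (V `|` N))).
  by apply: le_measure; rewrite ?inE//; exact: measurableU.
by rewrite measureU0.
Qed.
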